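(* There is a bounded-degree host digraph $H=([N],E)$ (that is, a family of such digraphs indexed by $N$, with all in- and out-degrees bounded by an absolute constant) such that $\mathrm{cbs}(\textsc{Q-EoL}_H)\ge\tilde\Omega(N)$.
   Context: The problem $\textsc{Q-EoL}_H$. For a host digraph $H=([N],E)$, an input $x\in\{0,1\}^E$ describes the spanning subgraph $G=G_x$ of $H$ consisting of the edges $e$ with $x_e=1$. The goal is to find a vertex $v\in[N]$ such that either - $v=1$ and ($\text{in-deg}(v)\ne0$ or $\text{out-deg}(v)\ne1$ in $G$); or - $v\ne1$ and ($\text{in-deg}(v)\ne1$ or $\text{out-deg}(v)\ne1$ in $G$). Convention: each isolated vertex of $G$ is interpreted as having a self-loop, so that an isolated vertex $v\neq 1$ does not count as a solution. Critical block sensitivity. Let $R\subseteq\{0,1\}^M\times\mathcal O$ be a search problem: on input $x$ the goal is to output some $o\in\mathcal O$ with $(x,o)\in R$. An input $x$ is critical if it admits a unique solution. Let $f\subseteq R$ denote a total function $f\colon\{0,1\}^M\to\mathcal O$ with $(x,f(x))\in R$ for all $x$. The block sensitivity $\mathrm{bs}(f,x)$ is the maximum number $b$ of pairwise disjoint blocks $B_1,\dots,B_b\subseteq[M]$ such that $f(x)\ne f(x^{B_i})$ for every $i$, where $x^{B_i}$ is $x$ with the bits in $B_i$ flipped. Then $$\mathrm{cbs}(R):=\min_{f\subseteq R}\ \max_{\text{critical }x}\ \mathrm{bs}(f,x).$$ The notation $\tilde\Omega(N)$ hides factors polylogarithmic in $N$. *)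

(* Defs.v *)
From mathcomp Require Import all_boot.

Set Implicit Arguments.
Unset Strict Implicit.
Unset Printing Implicit Defensive.

Section SearchProblems.

(* A search problem R on {0,1}^M with outputs in O is a relation between
   inputs and outputs. *)
Variables (M O : finType) (R : {ffun M -> bool} -> pred O).
Implicit Types (x : {ffun M -> bool}) (f : {ffun {ffun M -> bool} -> O}).

Definition flip x (B : {set M}) : {ffun M -> bool} :=
  [ffun i => x i (+) (i \in B)].

Definition critical x : bool := #|[set o | R x o]| == 1.

Definition solves f : bool := [forall x, R x (f x)].

(* A family of pairwise disjoint sensitive blocks has no repetitions, since a
   sensitive block is nonempty; hence it can be taken to be a set of blocks. *)
Definition bs f x : nat :=
  \max_(P : {set {set M}} |
          trivIset P && [forall B in P, f x != f (flip x B)]) #|P|.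

(* The neutral element #|M| bounds every bs f x, so for a total R this is the
   minimum over all f that solve R: see cbs_le and cbs_attained. *)
Definition cbs : nat :=
  \big[minn/#|M|]_(f | solves f) \max_(x | critical x) bs f x.

Lemma flip0 x : flip x set0 = x.
Proof. by apply/ffunP => i; rewrite ffunE inE addbF. Qed.

Lemma bs_le_card f x : bs f x <= #|M|.
Proof.
apply/bigmax_leqP => P /andP[/eqP trP /forall_inP sensP].
apply: leq_trans (max_card (mem (cover P))); rewrite -trP -sum1_card.
apply: leq_sum => B BP; rewrite card_gt0.
by apply: contraNneq (sensP _ BP) => ->; rewrite flip0.
Qed.

Lemma cbs_le f : solves f -> cbs <= \max_(x | critical x) bs f x.
Proof.
move=> sf; rewrite /cbs -big_filter.
have : f \in [seq g <- index_enum _ | solves g].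
  by rewrite mem_filter sf mem_index_enum.
elim: [seq _ <- _ | _] => //= g s IH; rewrite inE big_cons.
case/predU1P => [->|/IH]; first exact: geq_minl.
exact/leq_trans/geq_minr.
Qed.

Lemma cbs_attained :
  (forall x, exists o, R x o) ->
  exists2 f, solves f & cbs = \max_(x | critical x) bs f x.
Proof.
move=> totR; pose f0 := [ffun x => xchoose (totR x)].
have sf0 : solves f0 by apply/forallP => x; rewrite ffunE; exact: xchooseP.
pose F f := \max_(x | critical x) bs f x.
case: (arg_minnP F sf0) => f sf minf; exists f => //.
apply/eqP; rewrite eqn_leq cbs_le //= /cbs.
apply: (big_ind (fun m => F f <= m)) => [|m n lem len|g sg].
- by apply/bigmax_leqP => x _; exact: bs_le_card.
- by rewrite leq_min lem.
- exact: minf.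
Qed.

End SearchProblems.

Section Digraphs.

Variable N : nat.
Implicit Types (E G : {set 'I_N * 'I_N}) (v : 'I_N).

Definition out_deg G v : nat := #|[set w | (v, w) \in G]|.
Definition in_deg G v : nat := #|[set u | (u, v) \in G]|.

(* Loopless, with all in- and out-degrees at most d. *)
Definition bounded_degree_digraph (d : nat) E : Prop :=
  forall v, [/\ (v, v) \notin E, out_deg E v <= d & in_deg E v <= d].

Definition isolated G v : bool := (in_deg G v == 0) && (out_deg G v == 0).

Definition loop_isolated G : {set 'I_N * 'I_N} :=
  G :|: [set (v, v) | v : 'I_N & isolated G v].

Definition subgraph_of E (x : {ffun {e | e \in E} -> bool}) :
    {set 'I_N * 'I_N} := [set val e | e : {e | e \in E} & x e].

(* Vertices are numbered from 0: the distinguished vertex 1 of [N] is the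
   ordinal of value 0. *)
Definition Q_EoL E (x : {ffun {e | e \in E} -> bool}) : pred 'I_N :=
  fun v =>
    let G := loop_isolated (subgraph_of x) in
    if v == 0 :> nat then (in_deg G v != 0) || (out_deg G v != 1)
    else (in_deg G v != 1) || (out_deg G v != 1).

Lemma sum_out_deg G : \sum_v out_deg G v = #|G|.
Proof.
under eq_bigr => v _ do rewrite /out_deg -sum1dep_card big_mkcond.
by rewrite pair_big -sum1_card [RHS]big_mkcond; apply: eq_bigr => -[].
Qed.

Lemma sum_in_deg G : \sum_v in_deg G v = #|G|.
Proof.
under eq_bigr => v _ do rewrite /in_deg -sum1dep_card big_mkcond.
by rewrite exchange_big pair_big -sum1_card [RHS]big_mkcond;
   apply: eq_bigr => -[].
Qed.

Lemma Q_EoL_total E (x : {ffun {e | e \in E} -> bool}) :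
  0 < N -> exists v, Q_EoL x v.
Proof.
move=> N_gt0; pose s := Ordinal N_gt0; apply/existsP.
apply/contraT; rewrite negb_exists => /forallP noSol.
set G := loop_isolated (subgraph_of x).
have := sum_in_deg G; rewrite -(sum_out_deg G).
have := noSol s; rewrite /Q_EoL /= -/G negb_or !negbK => /andP[/eqP is0 /eqP os1].
rewrite (bigD1 s) //= [in RHS](bigD1 s) //= is0 os1.
have -> : \sum_(v | v != s) in_deg G v = \sum_(v | v != s) out_deg G v.
  apply: eq_bigr => v; rewrite -val_eqE /= => /negbTE v0.
  by have := noSol v; rewrite /Q_EoL v0 -/G negb_or !negbK => /andP[/eqP-> /eqP->].
by move/eqP; rewrite eqn_add2r.
Qed.

End Digraphs.

(* f = Omega~(g) at infinity, where Omega~ hides factors polylogarithmic in N: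
   f N >= c * g N / (log N)^k for all large N, with c = 1/C and denominators
   cleared; the floor of the base-2 logarithm only affects c. *)
Definition soft_Omega (f g : nat -> nat) : Prop :=
  exists C k N0 : nat,
    forall N, N0 <= N -> g N <= C * trunc_log 2 N ^ k * f N.

(* Main.v *)
(** Inputs are indexed by permutations p of T = {0,1}^(l+1) with a fixed s in T:
    the pair (u, p u) is joined by the butterfly path from u to p u, except for
    a := p^-1 s, whose path would return to s.  The resulting graph has a path
    from s to a and otherwise cycles, so a is its only solution.  Removing also
    the path of another u gives a graph which arises in the same way from the
    permutation with the images of a and u exchanged, whose only solution is u.
    A fixed solver therefore changes its answer from one of the two, and on
    average a constant fraction of all u is sensitive.

    Paths meet in the butterfly.  For most p at most O(l) of them visit a given
    node, so every node is blown up into a grid of O(l^2) vertices of degree at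
    most 2 which separates its paths, and a block meets only polylogarithmically
    many others; a maximal disjoint subfamily of the sensitive blocks is thus
    only polylogarithmically smaller than the whole family. *)

Require Import Defs.
From mathcomp Require Import all_boot fingroup perm zify.

Set Implicit Arguments.
Unset Strict Implicit.
Unset Printing Implicit Defensive.

(** * Ranks of used wires and the balance at a grid crossing *)

Definition count_below (P : pred nat) n := count P (iota 0 n).

Lemma count_belowS (P : pred nat) n : count_below P n.+1 = count_below P n + P n.
Proof. by rewrite /count_below -addn1 iotaD count_cat /= add0n addn0. Qed.

Lemma count_below_lt (P : pred nat) y n :
  y < n -> P y -> count_below P y < count_below P n.
Proof.
elim: n => // n IH; rewrite ltnS leq_eqVlt count_belowS => /predU1P[-> ->|/IH lt_y Py].
  by rewrite addn1.
exact: leq_trans (lt_y Py) (leq_addr _ _).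
Qed.

(** Wire [p] is number [p./2] of direction [odd p], so the first 2k wires contain k of each
    direction. *)
Lemma count_below_lanes (g : bool -> nat) k :
  count_below (fun p => p./2 < g (odd p)) k.*2 = minn k (g false) + minn k (g true).
Proof.
elim: k => [|k IH]; first by rewrite !min0n.
rewrite doubleS !count_belowS IH /= odd_double doubleK uphalf_double.
rewrite /=; lia.
Qed.

(* The vertex balance at the crossing of a row with a used in-wire (i) and a column
   with a used out-wire (o), of ranks a and b. *)
Lemma grid_balance (i o : bool) (a b : nat) :
  (i && (b <= a)) + (o && (a + i <= b)) = (i && (b + o <= a)) + (o && (a <= b)).
Proof. by case: i; case: o => /=; lia. Qed.

(** Turns used slots into degrees: since at most one of the two slots is used, the two candidate
    neighbours need not be distinct. *)
Lemma card_exists_bool (W : finType) (a : bool -> bool) (g : bool -> W) :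
  ~~ (a false && a true) ->
  #|[set w | [exists b, a b && (g b == w)]]| = a false + a true.
Proof.
move=> na; have E w : [exists b, a b && (g b == w)] =
    (a false && (g false == w)) || (a true && (g true == w)).
  apply/existsP/orP => [[[]]|[]]; [by right|by left|by exists false|by exists true].
case af: (a false) na E; case at_: (a true) => //= _ E.
- by rewrite addn0 -[RHS](cards1 (g false)); apply: eq_card => w;
  rewrite !inE E orbF eq_sym.
- by rewrite -[RHS](cards1 (g true)); apply: eq_card => w; rewrite !inE E eq_sym.
- by rewrite -[RHS](cards0 W); apply: eq_card => w; rewrite !inE E.
Qed.

(** * The butterfly network with its nodes blown up *)

Section Host.

Variables l K : nat.

Definition row := {ffun 'I_l.+1 -> bool}.
Definition lane := 'I_K.*2.+2.
Definition vertex := (row + ('I_l.+1 * row) * (lane * lane))%type.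
(* The slot (w, b) is one of the two possible edges out of w, or, depending on
   the context, into w.  In a grid vertex b = false is horizontal and b = true
   is vertical. *)
Definition slot := (vertex * bool)%type.

Implicit Types (r u v : row) (j : 'I_l.+1) (x y : lane) (b : bool) (s t : slot).

Definition set_bit r j b : row := [ffun i => if i == j then b else r i].

(* Where defined, next_slot sends the out-slot of an edge to its in-slot and
   prev_slot is its inverse; elsewhere both have junk values, and the edges of
   the host are those at which they agree.  Coordinates in a grid are (x, y):
   wires enter at x = 0 and leave at y = 0.  The wires are interleaved: wire p
   is the wire number p./2 among those of the direction odd p, the direction
   being the value of the bit that differs between consecutive levels. *)
Definition next_slot s : slot :=
  match s with
  | (inl u, _) => (inr ((ord0, u), (ord0, ord0)), false)
  | (inr ((j, r), (x, y)), false) => (inr ((j, r), (inord x.+1, y)), false)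
  | (inr ((j, r), (x, y)), true) =>
      if 0 < y then (inr ((j, r), (x, inord y.-1)), true)
      else if j < l then
        (inr ((inord j.+1, set_bit r j (odd x)), (ord0, inord (r j + x./2.*2))), false)
      else (inl (set_bit r j (odd x)), r j)
  end.

Definition prev_slot s : slot :=
  match s with
  | (inl v, b) =>
      (inr ((ord_max, set_bit v ord_max b), (inord (v ord_max), ord0)), true)
  | (inr ((j, r), (x, y)), false) =>
      if 0 < x then (inr ((j, r), (inord x.-1, y)), false)
      else if 0 < j then
        let i : 'I_l.+1 := inord j.-1 in
        (inr ((i, set_bit r i (odd y)), (inord (r i + y./2.*2), ord0)), true)
      else (inl r, false)
  | (inr ((j, r), (x, y)), true) => (inr ((j, r), (x, inord y.+1)), true)
  end.

Definition host : {set vertex * vertex} :=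
  [set e | [exists b, [&& (next_slot (e.1, b)).1 == e.2,
                          prev_slot (next_slot (e.1, b)) == (e.1, b) & e.1 != e.2]]].

(* The row visited at level j by the path from u to v. *)
Definition via j u v : row := [ffun i : 'I_l.+1 => if i < j then v i else u i].

Section Flow.

Variable R : {set row * row}.

Definition load j r : nat := #|[set p in R | via j p.1 p.2 == r]|.

Definition load_out j r b : nat :=
  #|[set p in R | (via j p.1 p.2 == r) && (p.2 j == b)]|.

(** An out-wire is labelled by the new value of bit j, an in-wire by the old value of bit j-1, so
    that the label determines the node at the other end. At level 0 the label is [false] by
    convention. *)
Definition load_in j r b : nat :=
  #|[set p in R | (via j p.1 p.2 == r) && (((0 < j) && p.1 (inord j.-1)) == b)]|.

Definition wire_in j r (p : nat) : bool := p./2 < load_in j r (odd p).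
Definition wire_out j r (p : nat) : bool := p./2 < load_out j r (odd p).

(* Inside a grid the i-th used wire entering at x = 0 runs horizontally to the
   column of the i-th used wire leaving at y = 0 and then down.  These L-shaped
   paths are nested, hence disjoint; comparing ranks says which edges they use. *)
Definition live s : bool :=
  match s with
  | (inl u, b) => ~~ b && (0 < load_in ord0 u false)
  | (inr ((j, r), (x, y)), false) =>
      wire_in j r y && (count_below (wire_out j r) x.+1 <= count_below (wire_in j r) y)
  | (inr ((j, r), (x, y)), true) =>
      wire_out j r x && (count_below (wire_in j r) y <= count_below (wire_out j r) x)
  end.

Definition live_in s : bool :=
  match s with
  | (inl v, b) => 0 < load_out ord_max (set_bit v ord_max b) (v ord_max)
  | (inr ((j, r), (x, y)), false) =>
      wire_in j r y && (count_below (wire_out j r) x <= count_below (wire_in j r) y)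
  | (inr ((j, r), (x, y)), true) =>
      wire_out j r x && (count_below (wire_in j r) y.+1 <= count_below (wire_out j r) x)
  end.

Definition flow : {set vertex * vertex} :=
  [set e | [exists b, live (e.1, b) && ((next_slot (e.1, b)).1 == e.2)]].

Lemma card_split_bool (A : {set row * row}) (g : row * row -> bool) :
  #|[set p in A | g p == false]| + #|[set p in A | g p == true]| = #|A|.
Proof.
rewrite addnC -[RHS](cardsID [set p | g p]); congr (_ + _); apply: eq_card => p;
  by rewrite !inE; case: (g p); rewrite ?andbT ?andbF.
Qed.

Lemma sum_load_out j r : load_out j r false + load_out j r true = load j r.
Proof.
rewrite -[RHS](card_split_bool _ (fun p => p.2 j)).
by congr (_ + _); apply: eq_card => p; rewrite !inE andbA.
Qed.

Lemma sum_load_in j r : load_in j r false + load_in j r true = load j r.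
Proof.
rewrite -[RHS](card_split_bool _ (fun p => (0 < j) && p.1 (inord j.-1))).
by congr (_ + _); apply: eq_card => p; rewrite !inE andbA.
Qed.

(** Passing to level j+1 overwrites bit j. The second conjunct on each side supplies the bit that
    the first one does not see: the old value [u j] on the left, the new value [v j] on the
    right. *)
Lemma set_bit_via_next j u v r b : j < l ->
  (via (inord j.+1) u v == set_bit r j b) && (u j == r j)
    = (via j u v == r) && (v j == b).
Proof.
move=> jl; have jE : (inord j.+1 : 'I_l.+1) = j.+1 :> nat by rewrite inordK.
apply/andP/andP => -[/eqP/ffunP e1 /eqP e2]; split; apply/eqP.
- apply/ffunP => i; have := e1 i; rewrite !ffunE jE ltnS (leq_eqVlt i j) -val_eqE /=.
  by case: (ltngtP i j) => //= /ord_inj ->.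
- by have := e1 j; rewrite !ffunE jE ltnS leqnn eqxx.
- apply/ffunP => i; have := e1 i; rewrite !ffunE jE ltnS (leq_eqVlt i j) -val_eqE /=.
  by case: (ltngtP i j) => //= /ord_inj ->.
- by have := e1 j; rewrite !ffunE ltnn.
Qed.

Lemma set_bit_via_max u v r b :
  (via ord_max u v == set_bit r ord_max b) && (v ord_max == r ord_max)
    = (v == r) && (u ord_max == b).
Proof.
apply/andP/andP => -[/eqP/ffunP e1 /eqP e2]; split; apply/eqP.
- apply/ffunP => i; have := e1 i; rewrite !ffunE -val_eqE /=.
  case: (ltngtP i l) (ltn_ord i) => //= [li|/(@ord_inj _ i ord_max) -> //].
  by rewrite ltnS leqNgt li.
- by have := e1 ord_max; rewrite !ffunE /= ltnn eqxx.
- apply/ffunP => i; have := e1 i; rewrite !ffunE -val_eqE /=.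
  case: (ltngtP i l) (ltn_ord i) => //= [li|/(@ord_inj _ i ord_max) -> //].
  by rewrite ltnS leqNgt li.
- by have := e1 ord_max.
Qed.

Lemma via0 u v : via ord0 u v = u.
Proof. by apply/ffunP => i; rewrite ffunE. Qed.

Lemma load_in_next j r b :
  j < l -> load_in (inord j.+1) (set_bit r j b) (r j) = load_out j r b.
Proof.
move=> jl; apply: eq_card => p; rewrite !inE -set_bit_via_next //.
by rewrite inordK //= inord_val.
Qed.

Definition dom_deg u := #|[set p in R | p.1 == u]|.
Definition cod_deg v := #|[set p in R | p.2 == v]|.

Lemma load_in0 u b : load_in ord0 u b = if b then 0 else dom_deg u.
Proof.
case: b; [apply: eq_card0|apply: eq_card] => p; rewrite !inE via0 /=.
  by rewrite !andbF.
by rewrite andbT.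
Qed.

Lemma load_out_max v b :
  load_out ord_max (set_bit v ord_max b) (v ord_max)
    = #|[set p in R | (p.2 == v) && (p.1 ord_max == b)]|.
Proof. by apply: eq_card => p; rewrite !inE set_bit_via_max. Qed.

Hypothesis capR : forall j r, load j r <= K.+1.
Hypothesis domR : forall u, dom_deg u <= 1.
Hypothesis codR : forall v, cod_deg v <= 1.

(** The capacity bound keeps the load in each direction at most K+1, so all used wires fit into the
    lanes and no minimum truncates. *)
Lemma count_wire_in j r : count_below (wire_in j r) K.*2.+2 = load j r.
Proof.
rewrite -doubleS (count_below_lanes (load_in j r)) !(minn_idPr _) ?sum_load_in //.
  by rewrite (leq_trans _ (capR j r)) // -sum_load_in leq_addl.
by rewrite (leq_trans _ (capR j r)) // -sum_load_in leq_addr.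
Qed.

Lemma count_wire_out j r : count_below (wire_out j r) K.*2.+2 = load j r.
Proof.
rewrite -doubleS (count_below_lanes (load_out j r)) !(minn_idPr _) ?sum_load_out //.
  by rewrite (leq_trans _ (capR j r)) // -sum_load_out leq_addl.
by rewrite (leq_trans _ (capR j r)) // -sum_load_out leq_addr.
Qed.

Lemma port_lt (b : bool) x : b + x./2.*2 < K.*2.+2.
Proof. by have := ltn_ord x; case: b; lia. Qed.

Lemma odd_port (b : bool) k : odd (b + k.*2) = b.
Proof. by rewrite oddD odd_double addbF; case: b. Qed.

Lemma half_port (b : bool) k : (b + k.*2)./2 = k.
Proof. by rewrite half_bit_double. Qed.

Lemma set_bitK r j b : set_bit (set_bit r j b) j (r j) = r.
Proof. by apply/ffunP => i; rewrite !ffunE; case: eqP => // ->. Qed.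

Lemma set_bitE r j b : set_bit r j b j = b.
Proof. by rewrite ffunE eqxx. Qed.

Lemma ord_wrap x : inord (odd x + x./2.*2) = x.
Proof. by rewrite odd_double_half inord_val. Qed.

Lemma load_out_max_le1 r b : load_out ord_max r b <= 1.
Proof.
have := load_out_max (set_bit r ord_max b) (r ord_max); rewrite set_bitE set_bitK => ->.
apply: leq_trans (codR (set_bit r ord_max b)); apply/subset_leq_card/subsetP => p.
by rewrite !inE => /and3P[-> ->].
Qed.

Lemma count_wire_in_lt j r y : wire_in j r y -> count_below (wire_in j r) y < load j r.
Proof. by rewrite -count_wire_in => ?; apply: count_below_lt. Qed.

Lemma count_wire_out_lt j r x :
  wire_out j r x -> count_below (wire_out j r) x < load j r.
Proof. by rewrite -count_wire_out => ?; apply: count_below_lt. Qed.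

(** With [live_in_prev] this matches used out-slots with used in-slots, so that in-degrees can be
    counted over in-slots. Ranks keep a path inside its grid, and between nodes both ends of a
    bundle of wires carry the same load. *)
Lemma live_next s : live s -> prev_slot (next_slot s) = s /\ live_in (next_slot s).
Proof.
case: s => -[u|[[j r] [x y]]] [] //=.
- move=> u_gt0; split=> //; rewrite /wire_in /=;
  exact: (andb_true_intro (conj u_gt0 _)).
- case/andP => wx le_yx; case: (posnP y) => [y0|y_gt0]; last first.
    have yE : (inord y.-1 : lane) = y.-1 :> nat.
      by rewrite inordK // (leq_ltn_trans (leq_pred _) (ltn_ord y)).
    by rewrite /= yE prednK // wx le_yx inord_val.
  have yE : ord0 = y by apply: val_inj.
  case: ltnP => [jl|lj] /=.
    have jE : (inord j.+1 : 'I_l.+1) = j.+1 :> nat by rewrite inordK.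
    rewrite jE /= inord_val set_bitE.
    rewrite inordK ?port_lt // odd_port half_port set_bitK.
    rewrite ord_wrap -yE; split=> //; apply/andP; split=> //.
    by rewrite /wire_in odd_port half_port load_in_next.
  have jE : j = ord_max by apply: val_inj; apply/eqP; rewrite eqn_leq lj -ltnS ltn_ord.
  rewrite {j lj}jE in wx le_yx *.
  (* At the last level each direction leads to a single row, where at most one path ends; hence only
     wire number 0 of a direction is used. *)
  have x2 : x./2 = 0.
    by apply/eqP; rewrite -leqn0 -ltnS (leq_trans wx) // load_out_max_le1.
  rewrite set_bitE set_bitK -yE; split; last by move: wx; rewrite /wire_out x2.
  by rewrite -[in RHS](ord_wrap x) x2 addn0.
- case/andP => wy le_xy.
  (* In the last column the out-count would be the whole load, but a used in-wire has a rank below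
     the load. *)
  have xS : x.+1 < K.*2.+2.
    rewrite ltn_neqAle ltn_ord andbT; apply: contraTneq le_xy => xE.
    by rewrite xE count_wire_out -ltnNge count_wire_in_lt.
  have xE : (inord x.+1 : lane) = x.+1 :> nat by rewrite inordK.
  by rewrite xE /= inord_val wy le_xy.
Qed.

Lemma live_in_prev t : live_in t -> next_slot (prev_slot t) = t /\ live (prev_slot t).
Proof.
case: t => -[v|[[j r] [x y]]] b /=.
- move=> v_gt0; have vE : (inord (v ord_max) : lane) = v ord_max :> nat.
    by rewrite inordK //; case: (v ord_max).
  rewrite ltnn vE oddb set_bitK set_bitE; split=> //.
  by apply/andP; split=> //; rewrite /wire_out oddb; case: (v ord_max) v_gt0.
case: b => /=.
- case/andP => wx le_yx.
  have yS : y.+1 < K.*2.+2.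
    rewrite ltn_neqAle ltn_ord andbT; apply: contraTneq le_yx => yE.
    by rewrite yE count_wire_in -ltnNge count_wire_out_lt.
  have yE : (inord y.+1 : lane) = y.+1 :> nat by rewrite inordK.
  by rewrite yE /= inord_val wx le_yx.
- case/andP => wy le_xy; case: (posnP x) => [x0|x_gt0]; last first.
    have xE : (inord x.-1 : lane) = x.-1 :> nat.
      by rewrite inordK // (leq_ltn_trans (leq_pred _) (ltn_ord x)).
    by rewrite /= xE prednK // wy le_xy inord_val.
  have xE : ord0 = x by apply: val_inj.
  case: (posnP j) => [j0|j_gt0] /=.
    have jE : j = ord0 by apply: val_inj.
    rewrite {j j0}jE in wy le_xy *.
    have : y./2 < load_in ord0 r (odd y) by [].
    rewrite load_in0; case oy: (odd y) => // y2;
      rewrite load_in0 (leq_ltn_trans _ y2) //.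
    have : y./2 = 0 by apply/eqP; rewrite -leqn0 -ltnS (leq_trans y2).
    move=> y20; split=> //; rewrite -xE; congr (inr (_, (_, _)), _).
    by rewrite -(ord_wrap y) oy y20; apply: val_inj; rewrite /= inordK.
  set i : 'I_l.+1 := inord j.-1.
  have iE : i = j.-1 :> nat by rewrite inordK // (leq_ltn_trans (leq_pred _)).
  have il : i < l by rewrite iE -ltnS prednK.
  have jE : inord i.+1 = j by rewrite iE prednK // inord_val.
  rewrite il inordK ?port_lt // odd_port half_port set_bitK set_bitE jE ord_wrap -xE.
  split=> //; apply/andP; split=> //.
  by rewrite /wire_out odd_port half_port -load_in_next // set_bitK jE set_bitE.
Qed.

Lemma live_loopless s : live s -> (next_slot s).1 != s.1.
Proof.
case: s => -[u|[[j r] [x y]]] [] //=.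
- case/andP => wx le_yx; case: (posnP y) => [y0|y_gt0]; last first.
    apply/eqP => -[] /(congr1 val) /=.
    by rewrite inordK ?(leq_ltn_trans (leq_pred _)) //;
      case: (val y) y_gt0 => //= n _ /n_Sn.
  case: ltnP => [jl|lj] //=; apply/eqP => -[] /(congr1 val) /=.
  by rewrite inordK // => /esym /n_Sn.
- case/andP => wy le_xy.
  have xS : x.+1 < K.*2.+2.
    rewrite ltn_neqAle ltn_ord andbT; apply: contraTneq le_xy => xE.
    by rewrite xE count_wire_out -ltnNge count_wire_in_lt.
  by apply/eqP => -[] /(congr1 val) /=; rewrite inordK // => /esym /n_Sn.
Qed.

Lemma flow_host : flow \subset host.
Proof.
apply/subsetP => e; rewrite !inE => /existsP[b /andP[ab /eqP eE]].
apply/existsP; exists b; have [/eqP -> _] := live_next ab.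
by rewrite eE eqxx -eE eq_sym (live_loopless ab).
Qed.

Lemma live_in_grid q x y :
  live_in (inr (q, (x, y)), false) + live_in (inr (q, (x, y)), true)
    = live (inr (q, (x, y)), false) + live (inr (q, (x, y)), true).
Proof. by case: q => j r /=; rewrite !count_belowS grid_balance. Qed.

(** The path of a row continues horizontally only while the rank of a used column is below that of
    the row, and a column is used only where its rank is at least that of the row. *)
Lemma live_grid_le1 q x y :
  ~~ (live (inr (q, (x, y)), false) && live (inr (q, (x, y)), true)).
Proof.
case: q => j r /=; rewrite count_belowS; case: (wire_out _ _ _); rewrite ?andbF //=.
by case: (wire_in _ _ _) => //=; lia.
Qed.

Lemma live_in_grid_le1 q x y :
  ~~ (live_in (inr (q, (x, y)), false) && live_in (inr (q, (x, y)), true)).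
Proof.
case: q => j r /=; rewrite count_belowS; case: (wire_in _ _ _) => //=.
by case: (wire_out _ _ _) => //=; rewrite ?andbF //; lia.
Qed.

(** The paths to [v] arrive from two nodes of the last level, told apart by the last bit of their
    sources. *)
Lemma live_in_row v : live_in (inl v, false) + live_in (inl v, true) = cod_deg v
  /\ ~~ (live_in (inl v, false) && live_in (inl v, true)).
Proof.
rewrite /= !load_out_max.
have <- : #|[set p in R | (p.2 == v) && (p.1 ord_max == false)]|
        + #|[set p in R | (p.2 == v) && (p.1 ord_max == true)]| = cod_deg v.
  rewrite -[RHS](card_split_bool _ (fun p => p.1 ord_max)).
  by congr (_ + _); apply: eq_card => p; rewrite !inE andbA.
have : #|[set p in R | (p.2 == v) && (p.1 ord_max == false)]|
     + #|[set p in R | (p.2 == v) && (p.1 ord_max == true)]| <= 1.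
  rewrite (leq_trans _ (codR v)) // -[leqRHS](card_split_bool _ (fun p => p.1 ord_max)).
  by apply: eq_leq; congr (_ + _); apply: eq_card => p; rewrite !inE andbA.
by case: #|_| => [|[|?]]; case: #|_| => [|[|?]].
Qed.

(** * Degrees in the flow *)

Definition outdeg (G : {set vertex * vertex}) w := #|[set w' | (w, w') \in G]|.
Definition indeg (G : {set vertex * vertex}) w := #|[set w' | (w', w) \in G]|.

Lemma in_flow w w' :
  ((w, w') \in flow) = [exists b, live (w, b) && ((next_slot (w, b)).1 == w')].
Proof. by rewrite inE. Qed.

Lemma outdeg_flow w : ~~ (live (w, false) && live (w, true)) ->
  outdeg flow w = live (w, false) + live (w, true).
Proof.
move=> na; rewrite -(card_exists_bool (fun b =>
  (next_slot (w, b)).1) (a := fun b => live (w, b))) //.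
by apply: eq_card => w'; rewrite !inE.
Qed.

Lemma indeg_flow w : ~~ (live_in (w, false) && live_in (w, true)) ->
  indeg flow w = live_in (w, false) + live_in (w, true).
Proof.
move=> na; rewrite -(card_exists_bool (fun b =>
  (prev_slot (w, b)).1) (a := fun b => live_in (w, b))) //.
apply: eq_card => w'; rewrite inE in_flow inE;
  apply/existsP/existsP => -[b /andP[ab /eqP <-]].
  have [pn an] := live_next ab; exists (next_slot (w', b)).2.
  by rewrite -surjective_pairing an pn eqxx.
have [np ap] := live_in_prev ab; exists (prev_slot (w, b)).2.
by rewrite -surjective_pairing ap np eqxx.
Qed.

Lemma outdeg_row u : outdeg flow (inl u) = dom_deg u.
Proof.
rewrite outdeg_flow /= ?andbF // load_in0 addn0.
by move: (domR u); case: (dom_deg u) => [|[]].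
Qed.

Lemma indeg_row v : indeg flow (inl v) = cod_deg v.
Proof. by have [<- na] := live_in_row v; rewrite indeg_flow. Qed.

Lemma flow_grid q x y : let w := inr (q, (x, y)) in
  indeg flow w = outdeg flow w /\ outdeg flow w <= 1.
Proof.
rewrite /= indeg_flow ?live_in_grid_le1 // outdeg_flow ?live_grid_le1 //.
split; first exact: live_in_grid.
by have := live_grid_le1 q x y; do 2 case: (live _).
Qed.

End Flow.
End Host.

(** * Locality and embedding into [N] *)

Lemma in_deg_loop N (G : {set 'I_N * 'I_N}) v :
  in_deg (loop_isolated G) v = if isolated G v then 1 else in_deg G v.
Proof.
have E u : ((u, v) \in loop_isolated G)
    = ((u, v) \in G) || ((u == v) && isolated G v).
  rewrite inE; congr (_ || _); apply/imsetP/andP => [[w iw [-> ->]]|[/eqP-> iv]].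
    by move: iw; rewrite inE eqxx.
  by exists v; rewrite ?inE.
rewrite /in_deg; case: ifP => iv; last first.
  by apply: eq_card => u; rewrite [LHS]inE [RHS]inE E iv andbF orbF.
have /andP[/eqP i0 _] := iv; rewrite -[RHS](cards1 v); apply: eq_card => u.
rewrite inE E iv andbT inE; have := card0_eq i0 u; rewrite inE => ->.
by rewrite orFb.
Qed.

Lemma out_deg_loop N (G : {set 'I_N * 'I_N}) v :
  out_deg (loop_isolated G) v = if isolated G v then 1 else out_deg G v.
Proof.
have E u : ((v, u) \in loop_isolated G)
    = ((v, u) \in G) || ((u == v) && isolated G v).
  rewrite inE; congr (_ || _); apply/imsetP/andP => [[w iw [-> ->]]|[/eqP-> iv]].
    by move: iw; rewrite inE eqxx.
  by exists v; rewrite ?inE.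
rewrite /out_deg; case: ifP => iv; last first.
  by apply: eq_card => u; rewrite [LHS]inE [RHS]inE E iv andbF orbF.
have /andP[_ /eqP i0] := iv; rewrite -[RHS](cards1 v); apply: eq_card => u.
rewrite inE E iv andbT inE; have := card0_eq i0 u; rewrite inE => ->.
by rewrite orFb.
Qed.

Section Local.

Variables l K : nat.
Notation row := (row l).
Notation vertex := (vertex l K).
Implicit Types (R : {set row * row}).

(** An edge out of a row vertex is charged to the level 0 node that it enters. *)
Definition node (w : vertex) : 'I_l.+1 * row :=
  match w with inl u => (ord0, u) | inr (q, _) => q end.

Definition thru R (q : 'I_l.+1 * row) := [set p in R | via q.1 p.1 p.2 == q.2].

(** The used edges at a node depend only on its loads, and these see only the paths through it.
    Removing a path may reroute others, but only inside the grids that it visits. *)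
Lemma live_local R R' w b :
  thru R (node w) = thru R' (node w) -> live R (w, b) = live R' (w, b).
Proof.
have inE1 S j r c : load_in S j r c
    = #|[set p in thru S (j, r) | ((0 < j) && p.1 (inord j.-1)) == c]|.
  by apply: eq_card => p; rewrite !inE andbA.
have outE S j r c : load_out S j r c = #|[set p in thru S (j, r) | p.2 j == c]|.
  by apply: eq_card => p; rewrite !inE andbA.
case: w => [u|[[j r] [x y]]] /= RR; first by rewrite !inE1 RR.
have wE : wire_in R j r =1 wire_in R' j r by move=> p; rewrite /wire_in !inE1 RR.
have oE : wire_out R j r =1 wire_out R' j r by move=> p; rewrite /wire_out !outE RR.
by rewrite /count_below !(eq_count wE) !(eq_count oE) wE oE.
Qed.

Lemma flow_local R R' w w' :
  thru R (node w) = thru R' (node w) ->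
  ((w, w') \in flow K R) = ((w, w') \in flow K R').
Proof.
move=> RR; rewrite !in_flow; apply: eq_existsb => b.
by rewrite (live_local b RR).
Qed.

Lemma card_imset_bool (W : finType) (g : bool -> W) : #|[set g b | b : bool]| <= 2.
Proof. by rewrite (leq_trans (leq_imset_card _ _)) // card_bool. Qed.

Lemma in_host w w' : ((w, w') \in host l K) =
  [exists b, [&& (next_slot (w, b)).1 == w', prev_slot (next_slot (w, b)) == (w, b)
    & w != w']].
Proof. by rewrite inE. Qed.

Lemma outdeg_host w : outdeg (host l K) w <= 2.
Proof.
apply: leq_trans (card_imset_bool (fun b => (next_slot (w, b)).1)).
apply/subset_leq_card/subsetP => w'; rewrite inE in_host.
by case/existsP => b /andP[/eqP <- _]; apply: imset_f; rewrite inE.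
Qed.

Lemma indeg_host w : indeg (host l K) w <= 2.
Proof.
apply: leq_trans (card_imset_bool (fun b => (prev_slot (w, b)).1)).
apply/subset_leq_card/subsetP => w'; rewrite inE in_host.
case/existsP => b /and3P[/eqP wE /eqP pE _]; apply/imsetP.
exists (next_slot (w', b)).2; rewrite ?inE // -wE -surjective_pairing.
by rewrite pE.
Qed.

Section Transport.

Variables (N : nat) (emb : vertex -> 'I_N).
Hypothesis emb_inj : injective emb.

Definition image_graph (G : {set vertex * vertex}) : {set 'I_N * 'I_N} :=
  [set (emb e.1, emb e.2) | e in G].

Lemma in_image_graph G w w' : ((emb w, emb w') \in image_graph G) = ((w, w') \in G).
Proof.
apply/imsetP/idP => [[[u u'] Gu [/emb_inj-> /emb_inj->]] //|Gw].
by exists (w, w').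
Qed.

Lemma out_deg_image G w : out_deg (image_graph G) (emb w) = outdeg G w.
Proof.
rewrite /outdeg -(card_imset _ emb_inj); apply: eq_card => v; rewrite inE.
apply/imsetP/imsetP => [[[u u'] Gu [/emb_inj-> ->]]|[w' Gw ->]].
  by exists u'; rewrite ?inE.
by exists (w, w') => //; move: Gw; rewrite inE.
Qed.

Lemma in_deg_image G w : in_deg (image_graph G) (emb w) = indeg G w.
Proof.
rewrite /indeg -(card_imset _ emb_inj); apply: eq_card => v; rewrite inE.
apply/imsetP/imsetP => [[[u u'] Gu [-> /emb_inj->]]|[w' Gw ->]].
  by exists u; rewrite ?inE.
by exists (w', w) => //; move: Gw; rewrite inE.
Qed.

Lemma deg_outside_image G v : (forall w, emb w != v) ->
  out_deg (image_graph G) v = 0 /\ in_deg (image_graph G) v = 0.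
Proof.
move=> nv; split; apply: eq_card0 => u; rewrite !inE; apply/imsetP => -[e _ []].
  by move=> vE _; have := nv e.1; rewrite vE eqxx.
by move=> _ vE; have := nv e.2; rewrite vE eqxx.
Qed.

Lemma codom_emb v : (exists w, v = emb w) \/ (forall w, emb w != v).
Proof.
have [/existsP[w /eqP <-]|] := boolP [exists w, emb w == v]; first by left; exists w.
by rewrite negb_exists => /forallP; right.
Qed.

Lemma bounded_image_host : bounded_degree_digraph 2 (image_graph (host l K)).
Proof.
move=> v; case: (codom_emb v) => [[w ->]|nv].
  rewrite out_deg_image in_deg_image in_image_graph outdeg_host indeg_host; split=> //.
  by rewrite in_host; apply/existsPn => b; rewrite eqxx !andbF.
have [-> ->] := deg_outside_image (host l K) nv; split=> //.
by apply/imsetP => -[e _ [vE _]]; have := nv e.1; rewrite vE eqxx.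
Qed.

Definition edge := {e | e \in image_graph (host l K)}.

Definition input R : {ffun edge -> bool} := [ffun e =>
  val e \in image_graph (flow K R)].

Lemma subgraph_input R :
  flow K R \subset host l K -> subgraph_of (input R) = image_graph (flow K R).
Proof.
move=> sub; apply/setP => e; apply/imsetP/idP => [[e' ie ->]|eG].
  by move: ie; rewrite inE ffunE.
have eE : e \in image_graph (host l K) by apply: (subsetP (imsetS _ sub)).
by exists (exist _ e eE); rewrite // inE ffunE.
Qed.

(* The tail of every edge is in the codomain of emb; the default is junk. *)
Definition tail (e : edge) : 'I_l.+1 * row :=
  if [pick w | emb w == (val e).1] is Some w then node w else (ord0, [ffun=> false]).

Lemma input_local R R' (e : edge) : thru R (tail e) = thru R' (tail e) ->
  input R e = input R' e.
Proof.
rewrite !ffunE /tail; case: pickP => [w /eqP ew|nw _].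
  move/flow_local => RR; case: e ew => -[u v] /= eE <-.
  case: (codom_emb v) => [[w' ->]|nv]; first by rewrite !in_image_graph.
  by apply/imsetP/imsetP => -[e _ [_ vE]]; have := nv e.2; rewrite vE eqxx.
by apply/imsetP/imsetP => -[g _ gE]; have := nw g.1; rewrite gE eqxx.
Qed.

End Transport.
End Local.

(** * Permutations and disjoint subfamilies *)

(** Take [W] of maximal size. Every member of [U] meets a block of [W], possibly its own, which is
    nonempty; and each block of [W] meets at most [D] others, itself included. *)
Lemma disjoint_subfamily (T M : finType) (U : {set T}) (B : T -> {set M}) D :
  (forall u, u \in U -> B u != set0) ->
  (forall u, u \in U -> #|[set w in U | ~~ [disjoint B u & B w]]| <= D) ->
  exists W : {set T}, [/\ W \subset U,
    {in W &, forall u w, u != w -> [disjoint B u & B w]} & #|U| <= D * #|W|].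
Proof.
move=> B0 deg.
pose P (W : {set T}) := (W \subset U)
  && [forall u in W, forall w in W, (u != w) ==> [disjoint B u & B w]].
have P0 : P set0 by rewrite /P sub0set; apply/forall_inP => u; rewrite inE.
case: (arg_maxnP (fun W : {set T} => #|W|) P0) => W /andP[WU /forall_inP dW] maxW.
exists W; split=> // [u w uW wW|].
  by have /forall_inP/(_ w wW)/implyP := dW u uW.
have cov : U \subset \bigcup_(w in W) [set u in U | ~~ [disjoint B w & B u]].
  apply/subsetP => u uU; apply/bigcupP.
  have [/exists_inP[w wW ndw]|/exists_inPn far] :=
    boolP [exists w in W, ~~ [disjoint B w & B u]].
    by exists w; rewrite // inE uU.
  have dj w : w \in W -> [disjoint B w & B u] by move/far; rewrite negbK.
  have uW : u \notin W.
    by apply: contraNN (B0 u uU) => /dj; rewrite -setI_eq0 setIid.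
  have /maxW : P (u |: W).
    apply/andP; split; first by rewrite subUset sub1set uU.
    apply/forall_inP => v vW; apply/forall_inP => w wW; apply/implyP.
    case/setU1P: vW => [->|vW]; case/setU1P: wW => [->|wW]; rewrite ?eqxx //.
    - by rewrite disjoint_sym dj.
    - by rewrite dj.
    by move=> vw; have /forall_inP/(_ w wW)/implyP/(_ vw) := dW v vW.
  by rewrite /= cardsU1 uW add1n ltnn.
apply: leq_trans (subset_leq_card cov) _.
rewrite mulnC -sum_nat_const.
apply: (@leq_trans (\sum_(w in W) #|[set u in U | ~~ [disjoint B w & B u]]|)).
  elim/big_rec2: _ => [|w n X _ le_n]; first by rewrite cards0.
  by rewrite (leq_trans (leq_card_setU _ _)) // leq_add2l.
by apply: leq_sum => w /(subsetP WU)/deg.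
Qed.

Lemma card_permT (T : finType) : #|{: {perm T}}| = #|T|`!.
Proof.
rewrite -cardsT -(card_perm [set: T]); apply: eq_card => p.
by rewrite !inE; apply/esym/subsetP => x _; rewrite inE.
Qed.

(** * Counting permutations that map one set into another *)

Section PermCount.

Variable T : finType.
Implicit Types (A B : {set T}) (p : {perm T}).

Definition perms_into A B := [set p : {perm T} | [forall u in A, p u \in B]].

(* Double counting of the pairs (p, u) with p u \in B and u \notin A: composing with
   tperm t u moves u to t. *)
Lemma perms_intoS A B t : t \notin A ->
  #|perms_into (t |: A) B| * (#|T| - #|A|) = #|perms_into A B| * (#|B| - #|A|).
Proof.
move=> tA; pose D u := [set p in perms_into A B | p u \in B].
have cD u : u \in ~: A -> #|perms_into (t |: A) B| = #|D u|.
  rewrite inE => uA; rewrite -(card_imset _ (@mulgI _ (tperm t u))).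
  apply: eq_card => p; rewrite inE; apply/imsetP/idP => [[q]|].
    rewrite inE => /forall_inP qB ->; rewrite !inE permM tpermR qB ?setU11 // andbT.
    apply/forall_inP => z zA; rewrite permM tpermD ?qB ?setU1r //.
      by apply: contraNneq tA => ->.
    by apply: contraNneq uA => ->.
  rewrite !inE => /andP[/forall_inP pB pu]; exists (tperm t u * p)%g; last first.
    by rewrite mulgA tperm2 mul1g.
  rewrite inE; apply/forall_inP => z /setU1P[->|zA]; rewrite permM ?tpermL //.
  rewrite tpermD ?pB //; first by apply: contraNneq tA => ->.
  by apply: contraNneq uA => ->.
have -> : #|T| - #|A| = #|~: A| by rewrite -(cardsC A) addKn.
rewrite mulnC -sum_nat_const (eq_bigr _ cD).
have cS u : #|D u| = \sum_(p in perms_into A B) (p u \in B).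
  rewrite -sum1_card (eq_bigl (fun p => (p \in perms_into A B) && (p u \in B))).
    by rewrite big_mkcondr; apply: eq_bigr => p _; case: (p u \in B).
  by move=> p; rewrite inE.
rewrite (eq_bigr _ (fun u _ => cS u)).
rewrite exchange_big /= -sum_nat_const; apply: eq_bigr => p.
rewrite inE => /forall_inP pB.
have AB : A \subset p @^-1: B by apply/subsetP => z zA; rewrite inE pB.
have <- : #|p @^-1: B| = #|B|.
  rewrite -(card_imset _ (@perm_inj _ p)); apply: eq_card => z; apply/imsetP/idP.
    by case=> w; rewrite inE => wB ->.
  by move=> zB; exists ((p^-1)%g z); rewrite ?inE permKV.
have -> : #|p @^-1: B| - #|A| = #|p @^-1: B :\: A|.
  by rewrite cardsD (setIidPr AB).
rewrite -sum1_card [RHS]big_mkcond [LHS]big_mkcond; apply: eq_bigr => u _.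
by rewrite !inE; case: (u \in A) => //=; case: (p u \in B).
Qed.

(** Iterating [perms_intoS] adds the points of [A] one by one. With denominators cleared, this
    bounds the probability that a random permutation maps [A] into [B]. *)
Lemma card_perms_into A B :
  #|perms_into A B| * #|T| ^_ #|A| <= #|B| ^_ #|A| * #|T|`!.
Proof.
move: {2}#|A| (erefl #|A|) => n; elim: n A => [|n IH] A An.
  by rewrite An !ffactn0 muln1 mul1n -card_permT max_card.
have [t tA] : exists t, t \in A by apply/card_gt0P; rewrite An.
have {An} An : #|A :\ t| = n by move: An; rewrite (cardsD1 t) tA => -[].
rewrite -(setD1K tA) cardsU1 !inE eqxx /= An !ffactnSr.
have := perms_intoS B (A := A :\ t) (t := t); rewrite !inE eqxx An => /(_ isT) pE.
rewrite mulnCA pE.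
rewrite mulnA [leqRHS]mulnAC leq_mul2r orbC -An.
by rewrite mulnC IH.
Qed.

End PermCount.

Lemma leq_ffact2l m n q : m <= n -> m ^_ q <= n ^_ q.
Proof. by move=> le_mn; rewrite !ffact_prod leq_prod // => i _; rewrite leq_sub2r. Qed.

Lemma ffact_mul_leq s d q : s ^_ q * d ^_ q <= (s * d) ^_ q.
Proof.
elim: q => [|q IH]; first by rewrite !ffactn0.
rewrite !ffactnSr mulnACA leq_mul //.
case: (posnP q) => [->|q_gt0]; first by rewrite !subn0.
case: (leqP q s) => qs; last by rewrite (eqP (ltnW qs)).
case: (leqP q d) => qd; last by rewrite (eqP (ltnW qd)) muln0.
(* (s-q)(d-q) = sd - q(s+d-q), and s+d-q is at least 1. *)
nia.
Qed.

Lemma card_pair_dep (A B : finType) (P : pred A) (Q : A -> pred B) :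
  #|[set d : A * B | P d.1 && Q d.1 d.2]| = \sum_(a | P a) #|[set b | Q a b]|.
Proof.
under [RHS]eq_bigr => a _ do rewrite -sum1dep_card.
by rewrite pair_big_dep sum1dep_card.
Qed.

(** * Averaging over pairs of a permutation and a point *)

Section Darts.

Variables (T : finType) (s : T).
Implicit Types p : {perm T}.

Definition hole p : T := (p^-1)%g s.

(** The marked point and the hole trade places, which makes this an involution. *)
Definition swap (d : {perm T} * T) := ((tperm (hole d.1) d.2 * d.1)%g, hole d.1).

Lemma hole_swap d : hole (swap d).1 = d.2.
Proof. by rewrite /hole /= invMg permM tpermV tpermL. Qed.

Lemma swapK d : swap (swap d) = d.
Proof.
by rewrite {1}/swap hole_swap /= mulgA tpermC tperm2 mul1g; case: d.
Qed.

Variables (good : pred {perm T}) (sens : {perm T} -> pred T).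

Hypothesis few_bad : 4 * #|[set p | ~~ good p]| <= #|T|`!.
Hypothesis sensP : forall p u, u != hole p -> good p -> good (swap (p, u)).1 ->
  sens p u || sens (swap (p, u)).1 (hole p).

(** For each pair (p, u) with u not the hole, the pair or its swap is sensitive with [p] good, or
    one of the two has a bad permutation. So the two sets [E], [B] and their swaps cover all pairs,
    and some good [p] reaches the average. *)
Lemma exists_sensitive :
  exists2 p, good p & #|T|.-1 <= 4 * #|[set u | (u != hole p) && sens p u]|.
Proof.
pose S := \sum_(p | good p) #|[set u | (u != hole p) && sens p u]|.
have cu p : #|[set u | u != hole p]| = #|T|.-1.
  by rewrite -(cardsC1 (hole p)); apply: eq_card => u; rewrite !inE.
pose B := [set d : {perm T} * T | ~~ good d.1 && (d.2 != hole d.1)].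
pose E := [set d : {perm T} * T | good d.1 && ((d.2 != hole d.1) && sens d.1 d.2)].
have cE : #|E| = S by exact: (card_pair_dep good (fun p u =>
  (u != hole p) && sens p u)).
have cB : #|B| = #|[set p | ~~ good p]| * #|T|.-1.
  rewrite (card_pair_dep (fun p => ~~ good p) (fun p u => u != hole p)).
  by under eq_bigr => p _ do rewrite cu; rewrite sum_nat_const cardsE.
have cA : #|[set d : {perm T} * T | true && (d.2 != hole d.1)]| = #|T|`! * #|T|.-1.
  rewrite (card_pair_dep xpredT (fun p u => u != hole p)).
  by under eq_bigr => p _ do rewrite cu; rewrite sum_nat_const card_permT.
have cov : [set d : {perm T} * T | true && (d.2 != hole d.1)]
    \subset (E :|: swap @: E) :|: (B :|: swap @: B).
  apply/subsetP => d; rewrite inE /= => dr.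
  have rd : (swap d).2 != hole (swap d).1 by rewrite hole_swap eq_sym.
  have swapI (X : {set {perm T} * T}) : swap d \in X -> d \in swap @: X.
    by move=> /(imset_f swap); rewrite swapK.
  have [g|b] := boolP (good d.1); last by rewrite !in_setU [d \in B]inE b dr !orbT.
  have [g'|b'] := boolP (good (swap d).1); last first.
    by rewrite !in_setU [d \in swap @: B]swapI ?orbT // inE b' rd.
  have := sensP (p := d.1) (u := d.2) dr g; rewrite -surjective_pairing.
  case/(_ g')/orP => sd; rewrite !in_setU.
    by rewrite [d \in E]inE g dr sd.
  by rewrite [d \in swap @: E]swapI ?orbT // inE g' rd.
(* With X the left side, the cover gives X <= 2S + 2|B|, and [few_bad] gives 4|B| <= X. *)
have {cov} : #|T|`! * #|T|.-1 <= 4 * S.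
  have := subset_leq_card cov; rewrite cA.
  have leU (X Y : {set {perm T} * T}) : #|X :|: Y| <= #|X| + #|Y|.
    by rewrite cardsU leq_subr.
  have := leU (E :|: swap @: E) (B :|: swap @: B).
  have := leU E (swap @: E); have := leU B (swap @: B).
  have leI (X : {set {perm T} * T}) : #|swap @: X| <= #|X| := leq_imset_card _ _.
  have := leI E; have := leI B.
  have : 4 * #|B| <= #|T|`! * #|T|.-1 by rewrite cB mulnA leq_mul2r few_bad orbT.
  rewrite cE; clear cE;
    move: (#|T|`! * #|T|.-1) S #|B| #|[set _ | _ in B]| #|[set _ | _ in E]|.
  move=> X Y b b' e; move: #|_ :|: (_ :|: _)| #|E :|: _| #|B :|: _|; clear; lia.
have Tgt0 := fact_gt0 #|T|.
have [/exists_inP[p gp lp] _|/exists_inPn small] :=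
  boolP [exists p in good, #|T|.-1 <= 4 * #|[set u | (u != hole p) && sens p u]|].
  by exists p.
have [p0 gp0] : exists p, p \in good.
  apply/card_gt0P; have := cardC good; rewrite card_permT.
  have -> : #|[predC good]| = #|[set p | ~~ good p]| by rewrite cardsE.
  by move: few_bad; lia.
(* This makes [#|T|.-2] a true predecessor, so that the final comparison is strict. *)
have m0 : 0 < #|T|.-1 by have := small p0 gp0; rewrite -ltnNge; apply: leq_ltn_trans.
rewrite /S big_distrr /= leqNgt => /negP[].
apply: (@leq_ltn_trans (\sum_(p | good p) #|T|.-2)).
  by apply: leq_sum => p /small; rewrite -ltnNge; case: #|T|.-1.
rewrite sum_nat_const (@leq_ltn_trans (#|T|`! * #|T|.-2)) //.
  by rewrite leq_mul2r -card_permT max_card orbT.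
by rewrite ltn_mul2l Tgt0 /= prednK.
Qed.

End Darts.

(** * Congestion and critical inputs *)

Section Congestion.

Variables l K : nat.
Notation row := (row l).
Implicit Types (j : 'I_l.+1) (r u v : row) (p : {perm row}) (W : {set row}).

Definition visitors p j r : {set row} := [set u | via j u (p u) == r].

Definition uncongested p : bool :=
  [forall j, forall r, #|visitors p j r| <= K.+1].

Lemma card_row : #|{: row}| = 2 ^ l.+1.
Proof. by rewrite card_ffun card_bool card_ord. Qed.

(** Congestion forces some q = K+2 sources of [S] to be mapped into [D]. With m rows, a union bound
    over the q-subsets of [S] gives the proportion C(|S|,q) |D|^_q / m^_q, which is at most 1/q!
    because |S||D| <= m. *)
Lemma few_congested_at j r :
  #|[set p | K.+1 < #|visitors p j r|]| * (K.+2)`! <= #|{: row}|`!.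
Proof.
pose S : {set row} := [set u : row | [forall i : 'I_l.+1, (j <= i) ==> (u i == r i)]].
pose D : {set row} := [set v : row | [forall i : 'I_l.+1, (i < j) ==> (v i == r i)]].
have viaE u v : (via j u v == r) = (u \in S) && (v \in D).
  rewrite !inE; apply/eqP/andP => [<-|[/forallP uS /forallP vD]].
    split; apply/forallP => i; apply/implyP => ij; rewrite ffunE ?ij //.
    by rewrite ltnNge ij.
  apply/ffunP => i; rewrite ffunE; case: ltnP => ij.
    by apply/eqP/(implyP (vD i)).
  by apply/eqP/(implyP (uS i)).
have cSD : #|S| * #|D| <= #|{: row}|.
  rewrite -cardsX.
  (* [S] is free in the bits below j and [D] in the others; [g] joins the two free parts, hence is
     injective on the product. *)
  pose g (w : row * row) : row := via j w.2 w.1.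
  rewrite -(card_in_imset (f := g)) ?max_card // => -[u v] [u' v'] /=.
  rewrite !inE /= => /andP[/forallP uS /forallP vD] /andP[/forallP uS' /forallP vD'].
  move=> /ffunP gE; congr (_, _); apply/ffunP => i; have := gE i; rewrite !ffunE /=.
    case: ltnP => // ij _.
    by rewrite (eqP (implyP (uS i) ij)) (eqP (implyP (uS' i) ij)).
  case: ltnP => // ij _.
  by rewrite (eqP (implyP (vD i) ij)) (eqP (implyP (vD' i) ij)).
set m := #|{: row}| in cSD *; set q := K.+2.
have cov : [set p | K.+1 < #|visitors p j r|] \subset
    \bigcup_(A in [set A : {set row} | A \subset S & #|A| == q]) perms_into A D.
  apply/subsetP => p; rewrite inE => /card_geqP[t [ut st tV]].
  apply/bigcupP; exists [set x in t].
    rewrite inE cardsE (card_uniqP ut) st eqxx andbT; apply/subsetP => u.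
    by rewrite inE => /tV; rewrite inE viaE => /andP[].
  rewrite inE; apply/forall_inP => u; rewrite inE => /tV.
  by rewrite inE viaE => /andP[].
case: (leqP q m) => [qm|mq]; last first.
  rewrite (_ : [set _ | _] = set0) ?cards0 //; apply/setP => p; rewrite !inE.
  by apply/negbTE; rewrite -leqNgt -ltnS (leq_ltn_trans (max_card _)).
have mq0 : 0 < m ^_ q by rewrite ffact_gt0.
rewrite -(leq_pmul2r mq0).
have le1 : #|[set p | K.+1 < #|visitors p j r|]| * m ^_ q
    <= 'C(#|S|, q) * (#|D| ^_ q * m`!).
  apply: (@leq_trans ((\sum_(A in [set A : {set row} | A \subset S & #|A| == q])
      #|perms_into A D|) * m ^_ q)).
    rewrite leq_mul2r; apply/orP; right; apply: leq_trans (subset_leq_card cov) _.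
    elim/big_rec2: _ => [|A n X _ le_n]; first by rewrite cards0.
    by rewrite (leq_trans (leq_card_setU _ _)) // leq_add2l.
  rewrite -cards_draws -sum_nat_const big_distrl /=; apply: leq_sum => A.
  by rewrite inE => /andP[_ /eqP <-]; exact: card_perms_into.
rewrite mulnAC (leq_trans (leq_mul le1 (leqnn _))) //.
rewrite mulnAC bin_ffact mulnA [leqRHS]mulnC leq_mul2r.
by rewrite (leq_trans (ffact_mul_leq _ _ _)) ?leq_ffact2l ?orbT.
Qed.

Lemma few_congested : 4 * (l.+1 * 2 ^ l.+1) <= (K.+2)`! ->
  4 * #|[set p | ~~ uncongested p]| <= #|{: row}|`!.
Proof.
move=> Kbig; have q0 := fact_gt0 K.+2.
rewrite -(leq_pmul2r q0) -mulnA.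
have le1 : #|[set p | ~~ uncongested p]| * (K.+2)`! <= l.+1 * 2 ^ l.+1 * #|{: row}|`!.
  have <- : #|{: 'I_l.+1 * row}|
    = l.+1 * 2 ^ l.+1 by rewrite card_prod card_ord card_row.
  rewrite -[leqRHS]sum_nat_const.
  apply: (@leq_trans (\sum_(q in {:
    'I_l.+1 * row}) #|[set p | K.+1 < #|visitors p q.1 q.2|]| * (K.+2)`!)); last first.
    by apply: leq_sum => -[j r] _; exact: few_congested_at.
  rewrite -big_distrl leq_mul2r /=; apply/orP; right.
  apply: (@leq_trans #|\bigcup_(q in {:
    'I_l.+1 * row}) [set p | K.+1 < #|visitors p q.1 q.2|]|).
    apply/subset_leq_card/subsetP => p; rewrite inE => /forallPn[j /forallPn[r jr]].
    by apply/bigcupP; exists (j, r); rewrite // inE ltnNge.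
  elim/big_rec2: _ => [|A n X _ le_n]; first by rewrite cards0.
  by rewrite (leq_trans (leq_card_setU _ _)) // leq_add2l.
rewrite (leq_trans (leq_mul (leqnn 4) le1)) // mulnA mulnC leq_mul2l.
by rewrite Kbig orbT.
Qed.

Definition pairs p W : {set row * row} := [set e | (e.1 \in W) && (e.2 == p e.1)].

Lemma card_pairs p W (Q : row -> row -> bool) :
  #|[set e in pairs p W | Q e.1 e.2]| = #|[set u in W | Q u (p u)]|.
Proof.
have inj : injective (fun u => (u, p u)) by move=> u v [].
rewrite -(card_imset _ inj); apply: eq_card => -[u v]; rewrite !inE /=.
apply/andP/imsetP => [[/andP[uW /eqP->] Quv]|[w]]; first by exists u; rewrite ?inE ?uW.
by rewrite inE => /andP[wW Qw] [-> ->]; rewrite wW eqxx.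
Qed.

Lemma load_pairs p W j r : uncongested p -> load (pairs p W) j r <= K.+1.
Proof.
move=> /forallP/(_ j)/forallP/(_ r); apply: leq_trans.
rewrite /load (card_pairs p W (fun u v => via j u v == r)).
by apply/subset_leq_card/subsetP => u; rewrite !inE => /andP[].
Qed.

Lemma dom_deg_pairs p W u : dom_deg (pairs p W) u = (u \in W).
Proof.
rewrite /dom_deg (card_pairs p W (fun u' _ => u' == u)).
case: (boolP (u \in W)) => uW.
  rewrite -[RHS](cards1 u); apply: eq_card => v; rewrite !inE.
  by case: eqP => [->|]; rewrite ?uW ?andbF.
apply: eq_card0 => v; rewrite !inE; case: eqP => [->|]; rewrite ?andbF //.
by rewrite (negbTE uW).
Qed.

Lemma cod_deg_pairs p W v : cod_deg (pairs p W) v = ((p^-1)%g v \in W).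
Proof.
rewrite -(dom_deg_pairs p) /cod_deg /dom_deg (card_pairs p W (fun _ w => w == v)).
rewrite (card_pairs p W (fun u _ => u == (p^-1)%g v)).
by apply: eq_card => u; rewrite !inE -(can2_eq (permK p) (permKV p)).
Qed.

(** The two permutations differ only at [a] and [u], where no path starts. *)
Lemma pairs_tperm p a u W : a \notin W -> u \notin W ->
  pairs (tperm a u * p)%g W = pairs p W.
Proof.
move=> aW uW; apply/setP => e; rewrite !inE; apply: andb_id2l => eW.
rewrite permM tpermD //; first by apply: contraNneq aW => ->.
by apply: contraNneq uW => ->.
Qed.

Variables (N : nat) (emb : vertex l K -> 'I_N) (s : row).
Hypothesis emb_inj : injective emb.
Hypothesis emb_root : emb (inl s) = 0 :> nat.

Notation graph p W := (flow K (pairs p W)).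

Lemma flow_pairs_host p W : uncongested p -> graph p W \subset host l K.
Proof.
move=> pU; apply: flow_host.
- by move=> j r; exact: load_pairs.
- by move=> v; rewrite cod_deg_pairs leq_b1.
Qed.

(** Only the hole lacks an out-edge and only [s] lacks an in-edge among the rows; all grid vertices
    are balanced. If the hole is [s] itself, [s] is isolated and its self-loop makes it a
    solution. *)
Lemma Q_EoL_crit p (v : 'I_N) : uncongested p ->
  Q_EoL (input emb (pairs p (~: [set hole s p]))) v = (v == emb (inl (hole s p))).
Proof.
move=> pU; set R := pairs _ _; set a := hole s p.
have capR j r : load R j r <= K.+1 by exact: load_pairs.
have domR u : dom_deg R u <= 1 by rewrite dom_deg_pairs leq_b1.
have codR u : cod_deg R u <= 1 by rewrite cod_deg_pairs leq_b1.
have vE : (v == 0 :> nat) = (v == emb (inl s)) by rewrite -val_eqE /= emb_root.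
rewrite /Q_EoL vE subgraph_input ?flow_pairs_host // in_deg_loop out_deg_loop.
rewrite /isolated.
case: (codom_emb emb v) => [[w ->]|nv]; last first.
  have [-> ->] := deg_outside_image (flow K R) nv.
  by rewrite ![v == _]eq_sym !(negbTE (nv _)).
rewrite out_deg_image // in_deg_image // !(inj_eq emb_inj).
case: w => [u|[q [x y]]]; last first.
  have nlr (z : row) : (inr (q, (x, y)) == inl z :> vertex l K) = false by [].
  have [-> o1] := flow_grid capR domR codR q x y; rewrite !nlr.
  by case: (outdeg _ _) o1 => [|[]].
rewrite outdeg_row // indeg_row // dom_deg_pairs cod_deg_pairs !inE.
have inlE (u1 u2 : row) : (inl u1 == inl u2 :> vertex l K) = (u1 == u2) by [].
rewrite !inlE /a /hole (inj_eq (@perm_inj _ (p^-1)%g)).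
by case: (u == s); case: (u == _).
Qed.

End Congestion.

(** * Block sensitivity *)

Section BlockSensitivity.

Variables (M O : finType) (f : {ffun {ffun M -> bool} -> O}).
Implicit Types x y : {ffun M -> bool}.

Definition diff x y : {set M} := [set e | x e != y e].

Lemma flip_diff x y : flip x (diff x y) = y.
Proof. by apply/ffunP => e; rewrite ffunE inE; case: (x e); case: (y e). Qed.

Lemma bs_ge_disjoint (T : finType) (W : {set T}) (B : T -> {set M}) x :
  (forall u, u \in W -> f x != f (flip x (B u))) ->
  {in W &, forall u w, u != w -> [disjoint B u & B w]} ->
  #|W| <= bs f x.
Proof.
move=> sB dB.
have B0 u : u \in W -> B u != set0.
  by move=> uW; apply: contraNneq (sB u uW) => ->; rewrite flip0.
have Binj : {in W &, injective B}.
  move=> u w uW wW Buw; apply/eqP; apply: contraNT (B0 u uW) => uw.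
  by have := dB u w uW wW uw; rewrite -Buw -setI_eq0 setIid.
rewrite -(card_in_imset Binj).
apply: (@leq_bigmax_cond _ _ (fun P : {set {set M}} => #|P|)).
apply/andP; split; last by apply/forall_inP => _ /imsetP[u uW ->]; exact: sB.
apply/trivIsetP => _ _ /imsetP[u uW ->] /imsetP[w wW ->] uw.
by apply: dB => //; apply: contraNneq uw => ->.
Qed.

End BlockSensitivity.

Section CbsBound.

Variables (l K N : nat) (emb : vertex l K -> 'I_N) (s : row l).
Hypothesis emb_inj : injective emb.
Hypothesis emb_root : emb (inl s) = 0 :> nat.
Hypothesis Kbig : 4 * (l.+1 * 2 ^ l.+1) <= (K.+2)`!.

Notation row := (row l).
Notation problem := (Q_EoL (E := image_graph emb (host l K))).
Implicit Types (p : {perm row}) (u w : row).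

Definition crit p := input emb (pairs p (~: [set hole s p])).
Definition cut p u := input emb (pairs p (~: [set hole s p; u])).

Lemma critical_crit p : uncongested K p -> critical problem (crit p).
Proof.
move=> pU; rewrite /critical -(cards1 (emb (inl (hole s p)))).
by apply/eqP; apply: eq_card => v; rewrite !inE Q_EoL_crit.
Qed.

Lemma cut_swap p u :
  cut (swap s (p, u)).1 (hole s p) = cut p u.
Proof.
rewrite /cut (hole_swap s (p, u)) /= setUC pairs_tperm // !inE ?eqxx ?orbT //.
Qed.

(** If the path of [u] avoids the node of the tail of [e], then [thru] there is unchanged and [e]
    keeps its value. *)
Lemma diff_cut p u e : e \in diff (crit p) (cut p u) ->
  via (tail e).1 u (p u) = (tail e).2.
Proof.
rewrite inE; apply: contraNeq => nv; apply/eqP; apply: input_local.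
  exact: emb_inj.
apply/setP => -[w v]; rewrite !inE /= negb_or.
case: (boolP (w == u)) => [/eqP ->|_]; last by rewrite andbT.
by have [->|_] := eqVneq v (p u); rewrite ?(negbTE nv) !andbF.
Qed.

(** Blocks sharing an edge belong to paths sharing the node of its tail; the path of [u] visits l+1
    nodes, each with at most K+1 visitors. *)
Lemma conflicts p u : uncongested K p ->
  #|[set w | ~~ [disjoint diff (crit p) (cut p u) & diff (crit p) (cut p w)]]|
    <= l.+1 * K.+1.
Proof.
move=> /forallP pU.
apply: (@leq_trans #|\bigcup_(j in 'I_l.+1) visitors p j (via j u (p u))|).
  apply/subset_leq_card/subsetP => w; rewrite inE => /pred0Pn[e /andP[eu ew]].
  apply/bigcupP; exists (tail e).1 => //.
  by rewrite inE (diff_cut eu) (diff_cut ew).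
rewrite -[in leqRHS](card_ord l.+1) -sum_nat_const.
elim/big_rec2: _ => [|j n X _ le_n]; first by rewrite cards0.
rewrite (leq_trans (leq_card_setU _ _)) // leq_add //.
by have /forallP := pU j; apply.
Qed.

Lemma cbs_host : 0 < N ->
  (2 ^ l.+1).-1 <= 4 * (l.+1 * K.+1) * cbs problem.
Proof.
move=> N0; have [f sf ->] := cbs_attained (R := problem) (fun x => Q_EoL_total x N0).
have fE p : uncongested K p -> f (crit p) = emb (inl (hole s p)).
  by move=> pU; apply/eqP; rewrite -(Q_EoL_crit emb_inj emb_root _ pU);
    exact: (forallP sf).
pose sens p u := f (crit p) != f (cut p u).
have sensP p u : u != hole s p -> uncongested K p -> uncongested K (swap s (p, u)).1 ->
    sens p u || sens (swap s (p, u)).1 (hole s p).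
  move=> up pU qU; rewrite /sens -negb_and.
  (* If neither answer changed, the common cut graph would get both the hole and [u] as its
     answer. *)
  apply: contraNN up => /andP[/eqP e1 /eqP]; rewrite cut_swap => e2.
  have := etrans (esym (fE _ qU)) (etrans e2 (etrans (esym e1) (fE _ pU))).
  by rewrite (hole_swap s (p, u)) => /emb_inj[->].
have [p pU] := exists_sensitive (few_congested Kbig) sensP.
rewrite card_row => /leq_trans; apply; rewrite -mulnA leq_mul2l /=.
set U := [set u | _].
pose B u := diff (crit p) (cut p u).
have UB u : u \in U -> f (crit p) != f (flip (crit p) (B u)).
  by rewrite inE flip_diff => /andP[].
have [||W [WU dW /leq_trans]] := @disjoint_subfamily _ _ U B (l.+1 * K.+1); last apply.
- by move=> u uU; apply: contraNneq (UB u uU) => ->; rewrite flip0.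
- move=> u _; apply: leq_trans (conflicts u pU).
  by apply/subset_leq_card/subsetP => w; rewrite !inE => /andP[].
rewrite leq_mul2l; apply/orP; right.
apply: leq_trans (leq_bigmax_cond _ (critical_crit pU)).
apply: (bs_ge_disjoint (B := B)) dW => u uW.
by apply: UB; apply: (subsetP WU).
Qed.

End CbsBound.

(** * Choice of parameters and the asymptotic bound *)

Lemma exists_inj_to (T : finType) (t : T) N : #|T| <= N ->
  exists2 emb : T -> 'I_N, injective emb & emb t = 0 :> nat.
Proof.
move=> TN; have N0 : 0 < N by apply: leq_trans TN; apply/card_gt0P; exists t.
pose r x := widen_ord TN (enum_rank x).
exists (fun x => tperm (r t) (Ordinal N0) (r x)); last by rewrite tpermL.
by move=> x y /perm_inj/(congr1 val)/= /ord_inj/enum_rank_inj.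
Qed.

(** [4 * l + 8] is the number of lanes [K.*2.+2] for [K = 2 * l + 3]. *)
Definition volume l := 2 ^ l.+1 * (1 + l.+1 * (4 * l + 8) ^ 2).

Lemma card_vertex l : #|{: vertex l (2 * l + 3)}| = volume l.
Proof.
rewrite card_sum !card_prod !card_ord card_row /volume mulnDr muln1.
congr (_ + _); rewrite (_ : (2 * l + 3).*2.+2 = 4 * l + 8); last by lia.
by rewrite mulnn -mulnA mulnCA.
Qed.

(** This is the hypothesis on [K] in [few_congested]. Raising l by one multiplies the left side by
    at most 4 and the right side by at least 42. *)
Lemma fact_lower_bound l : 4 * (l.+1 * 2 ^ l.+1) <= (2 * l + 5)`!.
Proof.
elim: l => [|l IH]; first by [].
rewrite (_ : 2 * l.+1 + 5 = (2 * l + 5).+2); last by lia.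
rewrite !factS expnS; move: IH; move: (2 ^ _) (_`!) => x y; nia.
Qed.

Lemma exists_host N l : volume l <= N ->
  exists2 E : {set 'I_N * 'I_N}, bounded_degree_digraph 2 E &
    (2 ^ l.+1).-1 <= 4 * (l.+1 * (2 * l + 4)) * cbs (Q_EoL (E := E)).
Proof.
rewrite -card_vertex => VN; pose s : row l := [ffun=> false].
have [emb emb_inj emb_s] := exists_inj_to (inl s) VN.
exists (image_graph emb (host l (2 * l + 3))); first exact: bounded_image_host.
have -> : 2 * l + 4 = (2 * l + 3).+1 by rewrite addnS.
apply: (cbs_host emb_inj emb_s); last exact: leq_ltn_trans (ltn_ord (emb (inl s))).
by rewrite -!addnS fact_lower_bound.
Qed.

Lemma volume_gt l : l < volume l.
Proof.
by rewrite (leq_trans (ltnW (ltn_expl l.+1 (ltnSn 1)))) // leq_pmulr.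
Qed.

Lemma soft_bound N l c : volume l <= N < volume l.+1 ->
  (2 ^ l.+1).-1 <= 4 * (l.+1 * (2 * l + 4)) * c ->
  N <= 64 * 289 * trunc_log 2 N ^ 5 * c.
Proof.
case/andP => lN Nl lc; set t := trunc_log 2 N.
have lt : l.+1 <= t by rewrite trunc_log_max // (leq_trans _ lN) // leq_pmulr.
apply: leq_trans (ltnW Nl) _.
have x1 : 0 < 2 ^ l by rewrite expn_gt0.
(* Here 2l+4 <= 4(l+1) <= 4t, and 2 * 4 * 4 = 32; these two powers of t come from the conflicts
   between blocks. *)
have le1 : 2 ^ l.+1 <= 32 * t ^ 2 * c.
  apply: (@leq_trans (2 * (2 ^ l.+1).-1)); first by rewrite expnS; lia.
  apply: (@leq_trans (2 * (4 * (l.+1 * (2 * l + 4)) * c))); first by rewrite leq_mul2l.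
  rewrite mulnA leq_mul2r; apply/orP; right; nia.
(* The factors are at most 2t and 12t, and 289 = 1 + 2 * 144; these three powers of t come from the
   size of the grids. *)
have le2 : 1 + l.+2 * (4 * l.+1 + 8) ^ 2 <= 289 * t ^ 3.
  apply: (@leq_trans (1 + (2 * t) * (12 * t) ^ 2)).
    rewrite leq_add2l leq_mul ?leq_exp2r //; lia.
  by have : 0 < t ^ 3; [rewrite expn_gt0; lia | rewrite expnMn; lia].
rewrite /volume expnS.
apply: (@leq_trans (2 * (32 * t ^ 2 * c) * (289 * t ^ 3))).
  by rewrite !leq_mul.
rewrite (expnD t 2 3); move: (t ^ 2) (t ^ 3) => a b.
lia.
Qed.

(** Boolean, so that [xchoose] can pick a host for every [N]. *)
Definition good_host N (E : {set 'I_N * 'I_N}) : bool :=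
  [forall v, [&& (v, v) \notin E, out_deg E v <= 2 & in_deg E v <= 2]]
  && ((volume 0 <= N) ==> (N <= 64 * 289 * trunc_log 2 N ^ 5 * cbs (Q_EoL (E := E)))).

Lemma exists_good_host N : exists E : {set 'I_N * 'I_N}, good_host E.
Proof.
case: (leqP (volume 0) N) => [N0|N0]; last first.
  exists set0; rewrite /good_host leqNgt N0 andbT; apply/forallP => v.
  rewrite inE /= /out_deg /in_deg; apply/andP.
  by split; rewrite (eq_card0 (A := [set _ | _])) // => w; rewrite !inE.
have bound l : volume l <= N -> l <= N by move/(leq_trans (volume_gt l))/ltnW.
(* The largest butterfly that fits into [N] vertices; the rest stay isolated. *)
case: (ex_maxnP (ex_intro (fun l => volume l <= N) 0 N0) bound) => l lN maxl.
have [E bE cE] := exists_host lN; exists E; rewrite /good_host; apply/andP; split.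
  by apply/forallP => v; apply/and3P; exact: bE.
apply/implyP => _; apply: soft_bound cE; rewrite lN ltnNge.
by apply/negP => /maxl; rewrite ltnn.
Qed.

Theorem lemma3 :
  exists (d : nat) (H : forall N : nat, {set 'I_N * 'I_N}),
    (forall N : nat, bounded_degree_digraph d (H N)) /\
    soft_Omega (fun N => cbs (Q_EoL (E := H N))) (fun N => N).
Proof.
exists 2, (fun N => xchoose (exists_good_host N)); split.
  by move=> N v; have /andP[/forallP/(_ v)/and3P] := xchooseP (exists_good_host N).
exists (64 * 289), 5, (volume 0) => N N0.
by have /andP[_ /implyP/(_ N0)] := xchooseP (exists_good_host N).
Qed.
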